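(* Let $A\in\mathbb{R}^{n\times n}$ be the adjacency matrix of an undirected, unweighted network on $n$ nodes with at least one edge ($A$ symmetric, $a_{ii}=0$, $a_{ij}\in\{0,1\}$), with spectral radius $\rho(A)$. Let $\mathbf{1}$ be the all-ones vector and $\mathbf{d}=A\mathbf{1}$. For $0<\alpha<1/\rho(A)$ let $\mathbf{x}(\alpha)=\sum_{k\ge0}\alpha^kA^k\mathbf{1}$ (equivalently, the solution of $(I-\alpha A)\mathbf{x}=\mathbf{1}$). Then there exists $\alpha^\star$ with $0<\alpha^\star\le 1/\rho(A)$ such that for all $0<\alpha<\alpha^\star$, \[ \frac{\mathbf{d}^T\mathbf{x}(\alpha)}{\|\mathbf{d}\|_1}-\frac{\|\mathbf{x}(\alpha)\|_1}{n}\ \ge\ 0, \] with equality if and only if the network is regular.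
   Context: $\|\mathbf{v}\|_1=\sum_i|v_i|$. $\mathbf{x}(\alpha)$ is the Katz centrality vector. A network is regular if all nodes have the same degree. *)

(* Defs.v *)
From HB Require Import structures.
From mathcomp Require Import all_boot all_order all_algebra.
From mathcomp Require Import complex.
From mathcomp Require Import all_classical all_reals all_analysis.

Set Implicit Arguments.
Unset Strict Implicit.
Unset Printing Implicit Defensive.

Import Order.TTheory GRing.Theory Num.Theory.
Import numFieldNormedType.Exports.

Local Open Scope classical_set_scope.
Local Open Scope ring_scope.

Section Network.
Variables (R : realType) (n : nat).
Implicit Types (A : 'M[R]_n) (v : 'cV[R]_n) (alpha : R).

Definition is_adjacency A : Prop :=
  [/\ A^T = A,
      forall i, A i i = 0 &
      forall i j, A i j = 0 \/ A i j = 1].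

Definition has_edge A : Prop := exists i j, A i j = 1.

(* Largest modulus of a complex eigenvalue. The set is finite, and nonempty
   when 0 < n, so that [sup] is then a maximum. *)
Definition spectral_radius A : R :=
  sup [set Normc.normc z |
        z in [set z : R[i] | eigenvalue (map_mx (real_complex R) A) z]].

Definition ones : 'cV[R]_n := const_mx 1.

Definition degree_vec A : 'cV[R]_n := A *m ones.

Definition regular A : Prop :=
  forall i j, degree_vec A i ord0 = degree_vec A j ord0.

(* The norm [`|v|] of the library on matrices is the max norm. *)
Definition norm1 v : R := \sum_i `|v i ord0|.

(* sum_(k >= 0) alpha^k A^k 1, summed entrywise. The series converges for
   0 < alpha < 1 / spectral_radius A; [limn] is a default value where a series
   diverges. *)
Definition katz A alpha : 'cV[R]_n :=
  \col_i limn (series (fun k : nat => (alpha ^+ k *: (A ^+ k *m ones)) i ord0)).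

End Network.
Arguments ones {R n}.

(* Main.v *)
(** The gap is a power series in [alpha] without constant term, whose linear
    coefficient is the variance of the degrees up to a positive factor.  If the
    network is regular, the two averages of the Katz vector agree.  Otherwise
    the variance is positive, and the remainder, at most
    [2 * alpha ^+ 2 * n ^+ 2] once [alpha * n <= 1/2], is negligible for small
    [alpha].  The spectral radius is positive because [A ^+ 2] has a positive
    diagonal entry, so that [A] is not nilpotent. *)

Require Import Defs.
From HB Require Import structures.
From mathcomp Require Import all_boot all_order all_algebra.
From mathcomp Require Import complex ring lra.
From mathcomp Require Import all_classical all_reals all_analysis.
Import Order.TTheory GRing.Theory Num.Theory.
Import numFieldNormedType.Exports.
Local Open Scope classical_set_scope.
Local Open Scope ring_scope.

(** * Nonnegative matrices and positivity of the spectral radius *)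

Lemma adjacency_ge0 (R : realType) (n : nat) (A : 'M[R]_n) :
  is_adjacency A -> forall i j, 0 <= A i j.
Proof. by case=> _ _ h i j; case: (h i j) => ->. Qed.

Lemma adjacency_le1 (R : realType) (n : nat) (A : 'M[R]_n) :
  is_adjacency A -> forall i j, A i j <= 1.
Proof. by case=> _ _ h i j; case: (h i j) => ->. Qed.

Lemma exprmx_ge0 (R : realType) (n : nat) (A : 'M[R]_n) :
  (forall i j, 0 <= A i j) -> forall k i j, 0 <= (A ^+ k) i j.
Proof.
move=> A0; elim=> [|k IH] i j; first by rewrite expr0 mxE; case: (i == j).
by rewrite exprS -mulmxE mxE; apply: sumr_ge0 => l _; exact: mulr_ge0.
Qed.

(** With nonnegative entries, the term through [i] alone bounds each product from below: a closed
    walk at [i] can be repeated. *)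
Lemma exprmx_diag_ge1 (R : realType) (n : nat) (B : 'M[R]_n) (i : 'I_n) :
  (forall i j, 0 <= B i j) -> 1 <= B i i -> forall k, 1 <= (B ^+ k) i i.
Proof.
move=> B0 Bii; elim=> [|k IH]; first by rewrite expr0 mxE eqxx.
rewrite exprS -mulmxE mxE (bigD1 i)//=.
have : 0 <= \sum_(l < n | l != i) B i l * (B ^+ k) l i.
  by apply: sumr_ge0 => l _; rewrite mulr_ge0// exprmx_ge0.
have := mulr_ege1 Bii IH; lra.
Qed.

Lemma adjacency_expr_neq0 (R : realType) (n : nat) (A : 'M[R]_n) :
  is_adjacency A -> has_edge A -> forall k, A ^+ k != 0.
Proof.
move=> adjA [i [j Aij]] k; apply/eqP => Ak0.
have A0 := adjacency_ge0 _ _ _ adjA.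
have Aji : A j i = 1 by case: adjA => AT _ _; rewrite -AT mxE.
(* Crossing the edge and coming back is a closed walk of length two. *)
have A2 : 1 <= (A ^+ 2) i i.
  rewrite exprS expr1 -mulmxE mxE (bigD1 j)//= Aij Aji mulr1 lerDl.
  by apply: sumr_ge0 => l _; exact: mulr_ge0.
have := exprmx_diag_ge1 _ _ (A ^+ 2) i (exprmx_ge0 _ _ _ A0 2) A2 k.
(* Swapping exponents turns [(A ^+ 2) ^+ k] into [(A ^+ k) ^+ 2], which is zero. *)
by rewrite -exprM mulnC exprM Ak0 exprS expr1 -mulmxE mul0mx mxE ler10.
Qed.

(** The characteristic polynomial splits and all its roots are 0, so it is ['X^n]; Cayley-Hamilton
    concludes. *)
Lemma nilpotent_of_eigenvalue0 (F : closedFieldType) (n : nat) (B : 'M[F]_n) :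
  (forall z, eigenvalue B z -> z = 0) -> B ^+ n = 0.
Proof.
case: n B => [|n] B h; first by rewrite flatmx0; apply/matrixP => -[].
have [r rE] := closed_field_poly_normal (char_poly B).
move: rE; rewrite (eqP (char_poly_monic B)) scale1r => rE.
have r0 : r = nseq (size r) 0.
  apply/all_pred1P/allP => z zr; apply/eqP/h.
  by rewrite eigenvalue_root_char rE root_prod_XsubC.
have sr : size r = n.+1.
  by have := size_char_poly B; rewrite rE size_prod_XsubC => -[].
have := Cayley_Hamilton B.
rewrite rE r0 sr big_nseq subr0 iter_mulr_1.
by rewrite rmorphXn /= horner_mx_X.
Qed.

Lemma spectral_radius_gt0 (R : realType) (n : nat) (A : 'M[R]_n) :
  is_adjacency A -> has_edge A -> 0 < spectral_radius A.
Proof.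
move=> adjA edgeA; set B := map_mx (real_complex R) A.
have [z Bz z0] : exists2 z, eigenvalue B z & z != 0.
  apply: contrapT => nz; have /eqP := adjacency_expr_neq0 _ _ _ adjA edgeA n.
  apply; apply: (@map_mx_inj _ _ (real_complex R)).
  rewrite map_mx0 rmorphXn; apply: nilpotent_of_eigenvalue0 => z Bz.
  by apply: contrapT => /eqP z0; apply: nz; exists z.
have [r rE] := closed_field_poly_normal (char_poly B).
move: rE; rewrite (eqP (char_poly_monic B)) scale1r => rE.
apply: (@lt_le_trans _ _ (Normc.normc z)).
  rewrite lt_neqAle eq_sym; apply/andP; split.
    by apply: contraNneq z0 => /Normc.eq0_normc ->.
  by case: z {Bz z0} => a b; exact: sqrtr_ge0.
apply: ub_le_sup; last by exists z.
(* An element is below [sup] only once the set is known to be bounded; the sum of the moduli of all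
   roots is a bound. *)
exists (\sum_(y <- r) Normc.normc y) => _ [y /= By <-].
have yr : y \in r by rewrite -root_prod_XsubC -rE -eigenvalue_root_char.
rewrite (big_rem y yr)/= lerDl; apply: sumr_ge0 => -[a b] _; exact: sqrtr_ge0.
Qed.

(** * Walk counts and degrees *)

Section Katz.
Variables (R : realType) (n : nat) (A : 'M[R]_n).
Hypothesis adjA : is_adjacency A.

Let d i := degree_vec A i ord0.

Lemma walks_ge0 k i : 0 <= (A ^+ k *m ones) i ord0.
Proof.
rewrite mxE; apply: sumr_ge0 => j _; rewrite mxE mulr1.
exact/exprmx_ge0/adjacency_ge0.
Qed.

(** A walk has at most [n] ways to continue at each step. This gives the Katz series a geometric
    majorant of ratio [alpha * n]. *)
Lemma walks_le k i : (A ^+ k *m ones) i ord0 <= n%:R ^+ k.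
Proof.
elim: k i => [|k IH] i; first by rewrite !expr0 mul1mx mxE.
rewrite exprS -mulmxE -mulmxA mxE.
apply: (@le_trans _ _ (\sum_(j < n) n%:R ^+ k)); last first.
  by rewrite sumr_const card_ord exprS mulr_natl.
apply: ler_sum => j _; rewrite -[leRHS]mul1r; apply: ler_pM => //.
- exact: adjacency_ge0.
- exact: walks_ge0.
- exact: adjacency_le1.
Qed.

Lemma degree_ge0 i : 0 <= d i.
Proof. by have := walks_ge0 1 i; rewrite expr1. Qed.

Lemma sum_degree_gt0 : has_edge A -> 0 < \sum_i d i.
Proof.
move=> [i [j Aij]]; rewrite (bigD1 i)//=; apply: ltr_pwDl; last first.
  by apply: sumr_ge0 => l _; exact: degree_ge0.
rewrite /d mxE (bigD1 j)//= mxE Aij mulr1; apply: ltr_pwDl => //.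
by apply: sumr_ge0 => l _; rewrite mxE mulr1; exact: adjacency_ge0.
Qed.

Lemma norm1_degree_vec : norm1 (degree_vec A) = \sum_i d i.
Proof. by apply: eq_bigr => i _; rewrite ger0_norm// degree_ge0. Qed.

(** * First-order bounds on the entries of the Katz vector *)

Section Series.
Variables (alpha : R) (i : 'I_n).
Hypotheses (alpha0 : 0 < alpha) (alphan : alpha * n%:R <= 1 / 2).

Let u k := (alpha ^+ k *: (A ^+ k *m ones)) i ord0.

Let u_ge0 k : 0 <= u k.
Proof. by rewrite /u mxE mulr_ge0 ?walks_ge0// exprn_ge0// ltW. Qed.

Let u_le k : u k <= (alpha * n%:R) ^+ k.
Proof.
by rewrite /u mxE exprMn ler_wpM2l ?walks_le// exprn_ge0// ltW.
Qed.

Let series2 : series u 2 = 1 + alpha * d i.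
Proof.
rewrite /series/= !big_nat_recr//= big_geq// add0r /u.
by rewrite !expr0 !expr1 mul1mx scale1r mxE mxE.
Qed.

Let series_ndecr : nondecreasing_seq (series u).
Proof.
by apply/nondecreasing_seqP => k; rewrite /series/= big_nat_recr//= lerDl.
Qed.

(* The subtracted term is what makes the induction go through. *)
Let series_le_aux m :
  series u m.+2 <= 1 + alpha * d i + 2 * (alpha * n%:R) ^+ 2
                   - 2 * (alpha * n%:R) ^+ m.+2.
Proof.
elim: m => [|m IH]; first by rewrite series2; lra.
rewrite /series/= big_nat_recr//=.
have q0 : 0 <= (alpha * n%:R) ^+ m.+2.
  by rewrite exprn_ge0// mulr_ge0// ltW.
(* With q = [alpha * n%:R] at most 1/2, the new term, at most q^(m+2), fits into 2 q^(m+2) - 2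
   q^(m+3). *)
have := ler_wpM2r q0 alphan; rewrite -exprS.
have := u_le m.+2; move: IH; rewrite /series/=; lra.
Qed.

Let series_le m :
  series u m <= 1 + alpha * d i + 2 * (alpha * n%:R) ^+ 2.
Proof.
(* The auxiliary bound starts at two terms; monotonicity covers the shorter sums. *)
apply: (le_trans (series_ndecr m m.+2 _)); first by rewrite !leqW.
apply: (le_trans (series_le_aux m)).
have q0 : 0 <= (alpha * n%:R) ^+ m.+2.
  by rewrite exprn_ge0// mulr_ge0// ltW.
lra.
Qed.

(** Bounded partial sums of nonnegative terms converge, so [limn] in [katz] is a genuine limit
    here. *)
Let cvg_series : cvgn (series u).
Proof.
apply: nondecreasing_is_cvgn => //.
by eexists => _ [m _ <-]; exact: series_le.
Qed.

Lemma katz_ge : 1 + alpha * d i <= katz A alpha i ord0.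
Proof.
by rewrite mxE -series2; exact: (nondecreasing_cvgn_le series_ndecr cvg_series).
Qed.

Lemma katz_le :
  katz A alpha i ord0 <= 1 + alpha * d i + 2 * (alpha * n%:R) ^+ 2.
Proof.
by rewrite mxE; apply: limr_le => //; apply: nearW => m; exact: series_le.
Qed.

Lemma katz_ge0 : 0 <= katz A alpha i ord0.
Proof.
by apply: le_trans katz_ge; rewrite addr_ge0// mulr_ge0 ?degree_ge0// ltW.
Qed.

End Series.

(** * Variance of the degrees *)

Lemma sum_sqr_deviation : (0 < n)%N ->
  \sum_i (d i - (\sum_j d j) / n%:R) ^+ 2
    = \sum_i d i ^+ 2 - (\sum_i d i) ^+ 2 / n%:R.
Proof.
move=> n0; set m := _ / _.
have nR : n%:R != 0 :> R by rewrite pnatr_eq0 -lt0n.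
under eq_bigr do rewrite sqrrB.
rewrite big_split/= sumrB sumr_const card_ord sumrMnl -mulr_suml.
rewrite -mulr_natl -mulr_natr /m; field.
exact: nR.
Qed.

(** A vanishing sum of squares would force every degree to equal [m]. *)
Lemma sum_sqr_deviation_gt0 (m : R) : ~ regular A ->
  0 < \sum_i (d i - m) ^+ 2.
Proof.
move=> nreg; rewrite lt_neqAle eq_sym sumr_ge0 ?andbT; last first.
  by move=> i _; exact: sqr_ge0.
apply/negP; rewrite psumr_eq0 => [/allP h|i _]; last exact: sqr_ge0.
apply: nreg => i j.
have dE l : d l = m.
  by have := h l (mem_index_enum _); rewrite /= sqrf_eq0 subr_eq0 => /eqP.
by rewrite -/(d i) -/(d j) !dE.
Qed.

(** * The gap between the two averages *)

Section Gap.
Variable alpha : R.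
Hypotheses (edgeA : has_edge A) (alpha0 : 0 < alpha).
Hypothesis alphan : alpha * n%:R <= 1 / 2.

Let x := katz A alpha.

Let gap := ((degree_vec A)^T *m x) ord0 ord0 / norm1 (degree_vec A)
           - norm1 x / n%:R.

Let n_gt0 : (0 < n)%N.
Proof. by case: edgeA => k _; exact: leq_ltn_trans (ltn_ord k). Qed.

Let nR0 : 0 < n%:R :> R. Proof. by rewrite ltr0n. Qed.

Let w1_gt0 : 0 < \sum_i d i. Proof. exact: sum_degree_gt0. Qed.

Lemma norm1_katz : norm1 x = \sum_i x i ord0.
Proof. by apply: eq_bigr => i _; rewrite ger0_norm// katz_ge0. Qed.

Lemma gapE : gap =
  (\sum_i d i * x i ord0) / (\sum_i d i) - (\sum_i x i ord0) / n%:R.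
Proof.
rewrite /gap norm1_degree_vec norm1_katz mxE.
by under eq_bigr do rewrite mxE.
Qed.

Lemma regular_gap : regular A -> gap = 0.
Proof.
move=> reg; rewrite gapE.
have [c dc] : exists c, forall i, d i = c.
  by exists (d (Ordinal n_gt0)) => i; exact: reg.
have w1E : \sum_i d i = c * n%:R.
  by under eq_bigr do rewrite dc; rewrite sumr_const card_ord mulr_natr.
under eq_bigr do rewrite dc.
rewrite w1E -mulr_sumr.
(* The common degree is nonzero because there is an edge; it then cancels from the weighted
   average. *)
have c0 : c != 0.
  by apply: contraTneq w1_gt0 => c0; rewrite w1E c0 mul0r ltxx.
by field; rewrite c0 lt0r_neq0.
Qed.

(** The lower bound on the Katz entries goes into the weighted average, the upper bound into the
    plain one. The constants 1 cancel, and the linear terms combine into the variance by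
    [sum_sqr_deviation]. *)
Lemma gap_ge :
  alpha * ((\sum_i (d i - (\sum_j d j) / n%:R) ^+ 2) / \sum_i d i)
    - 2 * (alpha * n%:R) ^+ 2 <= gap.
Proof.
rewrite gapE sum_sqr_deviation//.
set w1 := \sum_i d i; set w2 := \sum_i d i ^+ 2.
have lo : w1 + alpha * w2 <= \sum_i d i * x i ord0.
  rewrite /w1 /w2 mulr_sumr -big_split; apply: ler_sum => i _ /=.
  have := ler_wpM2l (degree_ge0 i) (katz_ge _ i alpha0 alphan).
  by apply: le_trans; rewrite mulrDr mulr1 expr2 mulrCA.
have hi : \sum_i x i ord0 <= n%:R + alpha * w1 + 2 * (alpha * n%:R) ^+ 2 * n%:R.
  have -> : n%:R + alpha * w1 + 2 * (alpha * n%:R) ^+ 2 * n%:R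
      = \sum_i (1 + alpha * d i + 2 * (alpha * n%:R) ^+ 2).
    by rewrite !big_split/= !sumr_const card_ord -mulr_sumr mulr_natr.
  by apply: ler_sum => i _; exact: katz_le.
have w1V : 0 <= w1^-1 by rewrite invr_ge0 ltW.
have nV : 0 <= n%:R^-1 :> R by rewrite invr_ge0 ltW.
apply: le_trans (lerB (ler_wpM2r w1V lo) (ler_wpM2r nV hi)).
rewrite le_eqVlt; apply/orP; left; apply/eqP; field.
by rewrite !lt0r_neq0.
Qed.

End Gap.
End Katz.

(** * Choice of the threshold *)

Theorem theorem5 (R : realType) (n : nat) (A : 'M[R]_n)
    (adjA : is_adjacency A) (edgeA : has_edge A) :
  exists alphastar : R,
    [/\ 0 < alphastar, alphastar <= 1 / spectral_radius A &
      forall alpha : R, 0 < alpha -> alpha < alphastar ->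
        let gap := ((degree_vec A)^T *m katz A alpha) ord0 ord0
                     / norm1 (degree_vec A)
                   - norm1 (katz A alpha) / n%:R in
        0 <= gap /\ (gap = 0 <-> regular A)].
Proof.
have rho0 : 0 < 1 / spectral_radius A by rewrite divr_gt0// spectral_radius_gt0.
have n0 : 0 < n%:R :> R.
  by rewrite ltr0n; case: edgeA => k _; exact: leq_ltn_trans (ltn_ord k).
have half0 : 0 < 1 / 2 / n%:R :> R by rewrite !divr_gt0.
have small (alpha : R) : alpha < 1 / 2 / n%:R -> alpha * n%:R <= 1 / 2.
  by rewrite ltr_pdivlMr// => /ltW.
have [reg|nreg] := pselect (regular A).
  (* The second bound ensures [alpha * n%:R <= 1 / 2], under which the Katz estimates hold. *)
  exists (Num.min (1 / spectral_radius A) (1 / 2 / n%:R)); split.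
  - by rewrite lt_min rho0.
  - by rewrite ge_min lexx.
  move=> alpha a0; rewrite lt_min => /andP[_ /small an] gap.
  by have -> : gap = 0 by exact: regular_gap.
pose w1 := \sum_i degree_vec A i ord0.
pose c := (\sum_i (degree_vec A i ord0 - w1 / n%:R) ^+ 2) / w1.
have c0 : 0 < c.
  by rewrite divr_gt0 ?sum_degree_gt0//; exact: sum_sqr_deviation_gt0.
have bound0 : 0 < c / (2 * n%:R ^+ 2).
  by rewrite divr_gt0// mulr_gt0// exprn_gt0.
(* The last bound is the value of [alpha] at which the linear term [alpha * c] equals the remainder
   [2 * (alpha * n%:R) ^+ 2]. *)
exists (Num.min (1 / spectral_radius A)
  (Num.min (1 / 2 / n%:R) (c / (2 * n%:R ^+ 2)))); split.
- by rewrite !lt_min rho0 half0.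
- by rewrite ge_min lexx.
move=> alpha a0; rewrite !lt_min => /and3P[_ /small an ac] gap.
have gap0 : 0 < gap.
  apply: lt_le_trans (gap_ge _ _ _ adjA alpha edgeA a0 an).
  rewrite -/w1 -/c subr_gt0.
  move: ac; rewrite ltr_pdivlMr ?mulr_gt0 ?exprn_gt0// => ac.
  have -> : 2 * (alpha * n%:R) ^+ 2 = alpha * (alpha * (2 * n%:R ^+ 2)) by ring.
  by rewrite ltr_pM2l.
split; first exact: ltW.
(* Both sides of the equivalence are false here. *)
by split => // g0; move: gap0; rewrite g0 ltxx.
Qed.
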